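(* For the knapsack problem with multiple, discrete weight improvements (iK-dm), there is an algorithm (a dynamic programming algorithm applied after profit scaling) which, given an instance and $\epsilon\in(0,1)$, returns a feasible solution with objective value at least $(1-\epsilon)\,\text{iK-dm}^*$ in $O\!\left(\frac{n^3\cdot Q\, C}{\epsilon}\right)$ time, where $\text{iK-dm}^*$ is the optimal objective value of the instance and $Q:=\max_i j(i)$.
   Context: The multi-level improvable knapsack problem with discrete weight improvements (iK-dm): there are $n$ items; item $i$ has profit $p_i\ge 0$, weights $w_i=w_i^0\ge w_i^1\ge\ldots\ge w_i^{j(i)}\ge 0$ and integer improvement costs $0=c_i^0\le c_i^1\le\ldots\le c_i^{j(i)}$, where $j(i)$ is the number of improvement levels of item $i$; assume $Q=\max_i j(i)\ge 1$. There are a knapsack budget $B\ge 0$ and a positive integer improvement budget $C$. The problem is $$\max \sum_{i=1}^n p_ix_i\quad\text{s.t.}\quad \sum_{i=1}^n w_i x_i+\sum_{i=1}^n\sum_{\ell=1}^{j(i)}(w_i^\ell-w_i^{\ell-1})y_i^\ell\le B,\quad \sum_{i=1}^n\sum_{\ell=1}^{j(i)}(c_i^\ell-c_i^{\ell-1})y_i^\ell\le C,$$ $$y_i^{j(i)}\le y_i^{j(i)-1}\le\ldots\le y_i^1\le x_i,\quad x_i\in\{0,1\},\quad y_i^\ell\in\{0,1\}\quad\text{for all } i\in\{1,\ldots,n\},\ \ell\in\{1,\ldots,j(i)\}.$$ Time is measured in elementary operations (arithmetic operations, comparisons and rounding down, each at unit cost). *)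

(* Defs.v *)
From HB Require Import structures.
From mathcomp Require Import all_boot all_order all_algebra.
Set Implicit Arguments.
Unset Strict Implicit.
Unset Printing Implicit Defensive.
Import Order.TTheory GRing.Theory Num.Theory.
Local Open Scope ring_scope.

(* [weight i l] and [icost i l] are the weight w_i^l and the improvement cost
   c_i^l; they are meaningful for l <= [levels i] only, and nothing below reads
   them beyond that level. *)
Record instance (R : archiRealFieldType) := Instance {
  items   : nat;
  profit  : 'I_items -> R;
  levels  : 'I_items -> nat;
  weight  : 'I_items -> nat -> R;
  icost   : 'I_items -> nat -> int;
  kbudget : R;
  ibudget : int }.

Definition maxlevel (R : archiRealFieldType) (I : instance R) : nat :=
  (\max_(i < items I) levels i)%N.

Record valid (R : archiRealFieldType) (I : instance R) : Prop := Valid {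
  profit_ge0     : forall i : 'I_(items I), 0 <= profit i;
  weight_noninc  : forall (i : 'I_(items I)) (l : nat),
                     (l < levels i)%N -> weight i l.+1 <= weight i l;
  weight_last    : forall i : 'I_(items I), 0 <= weight i (levels i);
  icost0         : forall i : 'I_(items I), icost i 0 = 0;
  icost_nondec   : forall (i : 'I_(items I)) (l : nat),
                     (l < levels i)%N -> icost i l <= icost i l.+1;
  maxlevel_ge1   : (1 <= maxlevel I)%N;
  kbudget_ge0    : 0 <= kbudget I;
  ibudget_gt0    : 0 < ibudget I }.

(* An assignment of the variables x_i and y_i^l.  Levels are shifted by one:
   the variable y_i^(l+1) is indexed by l : 'I_(levels i). *)
Definition solution (R : archiRealFieldType) (I : instance R) : Type :=
  ({ffun 'I_(items I) -> bool} *
   {ffun {i : 'I_(items I) & 'I_(levels i)} -> bool})%type.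

Section Problem.
Variables (R : archiRealFieldType) (I : instance R).
Implicit Types (s : solution I) (i : 'I_(items I)).

Definition xvar s i : bool := s.1 i.
Definition yvar s i (l : 'I_(levels i)) : bool :=
  s.2 (Tagged (fun i => 'I_(levels i)) l).

Definition objective s : R := \sum_i profit i * (xvar s i)%:R.

Definition total_weight s : R :=
  \sum_i weight i 0 * (xvar s i)%:R +
  \sum_i \sum_(l < levels i)
     (weight i l.+1 - weight i l) * (yvar s l)%:R.

Definition total_icost s : int :=
  \sum_i \sum_(l < levels i) (icost i l.+1 - icost i l) * (yvar s l)%:R.

Definition nested s : bool :=
  [forall i,
     [forall l : 'I_(levels i), (l == 0 :> nat) ==> (yvar s l <= xvar s i)%N]
  && [forall l : 'I_(levels i), [forall l' : 'I_(levels i),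
        (l' == l.+1 :> nat) ==> (yvar s l' <= yvar s l)%N]]].

Definition feasible s : bool :=
  [&& total_weight s <= kbudget I, total_icost s <= ibudget I & nested s].

(* The default value 0 does not interfere with the maximum: see [opt_max]. *)
Definition opt : R := \big[Num.max/0]_(s : solution I | feasible s) objective s.

Lemma opt_max : valid I ->
  (exists2 s, feasible s & objective s = opt) /\
  (forall s, feasible s -> objective s <= opt).
Proof.
move=> vI; split; last by move=> s fs; exact: (le_bigmax_cond 0 objective fs).
pose s0 : solution I := ([ffun=> false], [ffun=> false]).
have fs0 : feasible s0.
  apply/and3P; split.
  - rewrite /total_weight !big1 ?addr0 ?kbudget_ge0 // => i _.
      by rewrite big1 // => l _; rewrite /yvar ffunE mulr0.
    by rewrite /xvar ffunE mulr0.
  - rewrite /total_icost big1 ?ltW ?ibudget_gt0 // => i _.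
    by rewrite big1 // => l _; rewrite /yvar ffunE mulr0.
  - apply/forallP => i; apply/andP; split; apply/forallP => l.
      by apply/implyP => _; rewrite /yvar ffunE.
    by apply/forallP => l'; apply/implyP => _; rewrite /yvar !ffunE.
have obj_ge0 s : feasible s -> 0 <= objective s.
  by move=> _; apply: sumr_ge0 => i _; rewrite mulr_ge0 ?profit_ge0 ?ler0n.
rewrite /opt (bigmax_eq_arg 0 s0) //.
by case: arg_maxP => // s fs _; exists s.
Qed.

End Problem.

(* A structured program over finitely many scalar variables and finitely many
   two-dimensional arrays, all holding numbers.  The syntax does not mention
   the field, and the only constants are natural numbers, so a program is one
   finite object, independent of the instance. *)
Inductive expr :=
  | Lit of nat
  | Var of nat
  | Read of nat & expr & expr     (* array, row, column *)
  | Add of expr & expr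
  | Sub of expr & expr
  | Mul of expr & expr
  | Div of expr & expr
  | Floor of expr.

Inductive test :=
  | Le of expr & expr
  | Lt of expr & expr
  | Eq of expr & expr.

Inductive cmd :=
  | Skip
  | Assign of nat & expr
  | Write of nat & expr & expr & expr     (* array, row, column, value *)
  | Seq of cmd & cmd
  | If of test & cmd & cmd
  | While of test & cmd.

Record state (R : archiRealFieldType) := State {
  var : nat -> R;
  arr : nat -> nat -> nat -> R }.

Section Semantics.
Variable R : archiRealFieldType.
Implicit Types (st : state R) (e : expr) (b : test).

Definition set_var st (v : nat) (x : R) : state R :=
  State (fun u => if u == v then x else var st u) (arr st).

Definition set_arr st (a r k : nat) (x : R) : state R :=
  State (var st)
    (fun a' r' k' => if [&& a' == a, r' == r & k' == k] then x
                     else arr st a' r' k').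

(* Indices are rounded to natural numbers by [Num.truncn]; x / 0 is 0. *)
Fixpoint eval st e : R :=
  match e with
  | Lit k => k%:R
  | Var v => var st v
  | Read a e1 e2 => arr st a (Num.truncn (eval st e1)) (Num.truncn (eval st e2))
  | Add e1 e2 => eval st e1 + eval st e2
  | Sub e1 e2 => eval st e1 - eval st e2
  | Mul e1 e2 => eval st e1 * eval st e2
  | Div e1 e2 => eval st e1 / eval st e2
  | Floor e1 => (Num.floor (eval st e1))%:~R
  end.

Definition holds st b : bool :=
  match b with
  | Le e1 e2 => eval st e1 <= eval st e2
  | Lt e1 e2 => eval st e1 < eval st e2
  | Eq e1 e2 => eval st e1 == eval st e2
  end.

(* Every arithmetic operation, comparison, rounding and memory access takes one
   unit of time. *)
Fixpoint expr_time e : nat :=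
  match e with
  | Lit _ | Var _ => 0
  | Read _ e1 e2 | Add e1 e2 | Sub e1 e2 | Mul e1 e2 | Div e1 e2 =>
      (expr_time e1 + expr_time e2).+1
  | Floor e1 => (expr_time e1).+1
  end.

Definition test_time b : nat :=
  match b with
  | Le e1 e2 | Lt e1 e2 | Eq e1 e2 => (expr_time e1 + expr_time e2).+1
  end.

(* [exec c st st' t]: started in [st], [c] halts in [st'] after time [t]. *)
Inductive exec : cmd -> state R -> state R -> nat -> Prop :=
  | ExecSkip st : exec Skip st st 0
  | ExecAssign st v e :
      exec (Assign v e) st (set_var st v (eval st e)) (expr_time e).+1
  | ExecWrite st a e1 e2 e :
      exec (Write a e1 e2 e) st
        (set_arr st a (Num.truncn (eval st e1)) (Num.truncn (eval st e2))
           (eval st e))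
        (expr_time e1 + expr_time e2 + expr_time e).+1
  | ExecSeq c1 c2 st st1 st2 t1 t2 :
      exec c1 st st1 t1 -> exec c2 st1 st2 t2 ->
      exec (Seq c1 c2) st st2 (t1 + t2)
  | ExecIfT b c1 c2 st st' t :
      holds st b -> exec c1 st st' t ->
      exec (If b c1 c2) st st' (test_time b + t)
  | ExecIfF b c1 c2 st st' t :
      ~~ holds st b -> exec c2 st st' t ->
      exec (If b c1 c2) st st' (test_time b + t)
  | ExecWhileF b c st :
      ~~ holds st b -> exec (While b c) st st (test_time b)
  | ExecWhileT b c st st1 st2 t1 t2 :
      holds st b -> exec c st st1 t1 -> exec (While b c) st1 st2 t2 ->
      exec (While b c) st st2 (test_time b + t1 + t2).

Lemma exec_det c st st1 st2 t1 t2 :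
  exec c st st1 t1 -> exec c st st2 t2 -> st1 = st2 /\ t1 = t2.
Proof.
move=> H; elim: H st2 t2 => {c st st1 t1}.
- by move=> st st2 t2 H; inversion H.
- by move=> st v e st2 t2 H; inversion H.
- by move=> st a e1 e2 e st2 t2 H; inversion H.
- move=> c1 c2 st st1 st2 t1 t2 _ IH1 _ IH2 st3 t3 H; inversion H; subst.
  match goal with h : exec c1 _ _ _ |- _ => case: (IH1 _ _ h) => ? ?; subst end.
  by match goal with h : exec c2 _ _ _ |- _ => case: (IH2 _ _ h) => ? ?; subst end.
- move=> b c1 c2 st st1 t hb _ IH st2 t2 H; inversion H; subst.
    by match goal with h : exec c1 _ _ _ |- _ => case: (IH _ _ h) => ? ?; subst end.
  by match goal with h : is_true (~~ _) |- _ => rewrite hb in h end.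
- move=> b c1 c2 st st1 t hb _ IH st2 t2 H; inversion H; subst.
    by match goal with h : is_true (holds _ _) |- _ => rewrite h in hb end.
  by match goal with h : exec c2 _ _ _ |- _ => case: (IH _ _ h) => ? ?; subst end.
- move=> b c st hb st2 t2 H; inversion H; subst=> //.
  by match goal with h : is_true (holds _ _) |- _ => rewrite h in hb end.
- move=> b c st st1 st2 t1 t2 hb _ IH1 _ IH2 st3 t3 H; inversion H; subst.
    by match goal with h : is_true (~~ _) |- _ => rewrite hb in h end.
  match goal with h : exec c _ _ _ |- _ => case: (IH1 _ _ h) => ? ?; subst end.
  by match goal with h : exec (While _ _) _ _ _ |- _ =>
       case: (IH2 _ _ h) => ? ?; subst end.
Qed.

(* Memory that does not hold the input is arbitrary.  The number Q is not part
   of the input. *)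
Record encodes st (I : instance R) (eps : R) : Prop := Encodes {
  in_items   : var st 0 = (items I)%:R;
  in_kbudget : var st 1 = kbudget I;
  in_ibudget : var st 2 = (ibudget I)%:~R;
  in_eps     : var st 3 = eps;
  in_profit  : forall i : 'I_(items I), arr st 0 i 0 = profit i;
  in_levels  : forall i : 'I_(items I), arr st 1 i 0 = (levels i)%:R;
  in_weight  : forall (i : 'I_(items I)) (l : nat), (l <= levels i)%N ->
                 arr st 2 i l = weight i l;
  in_icost   : forall (i : 'I_(items I)) (l : nat), (l <= levels i)%N ->
                 arr st 3 i l = (icost i l)%:~R }.

Record returns st (I : instance R) (s : solution I) : Prop := Returns {
  out_x : forall i : 'I_(items I), arr st 4 i 0 = (xvar s i)%:R;
  out_y : forall (i : 'I_(items I)) (l : 'I_(levels i)),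
            arr st 5 i l.+1 = (yvar s l)%:R }.

End Semantics.

(* Main.v *)
Require Import Defs.
From mathcomp Require Import all_boot all_order all_algebra.
From mathcomp Require Import zify ring.
Set Implicit Arguments.
Unset Strict Implicit.
Unset Printing Implicit Defensive.
Import Order.TTheory GRing.Theory Num.Theory.
Local Open Scope ring_scope.

(** Let [m] be the largest profit of an item that fits into the knapsack on its
    own at some improvement level of cost at most C, or 0 if there is none.  Then
    [m] is at most the
    optimum, and every item of a feasible solution has profit at most [m].  If
    [m] is 0, the optimum is 0 and any feasible solution will do; otherwise,
    replace the profit p_i by the integer gain floor (p_i * n / (eps * m)),
    that is, round p_i down to a multiple of k = eps * m / n.  Rounding costs
    less than k per item, hence at most n * k = eps * m <= eps * opt in total,
    so a feasible solution of maximal gain is a (1 - eps)-approximation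
    ([value_approx]).

    Gains of feasible solutions are at most n^2 / eps ([fitting_gain_le]), so
    maximal gain can be found by dynamic programming on [min_weight i P c], the
    least weight of a choice among the first i items with gain at least P and
    improvement cost at most c.  That [min_weight] bounds every choice from
    below is [min_weight_le]; that a value within the knapsack budget belongs
    to an actual choice is shown by following the recorded decisions backwards
    ([runs_trace_back]).  There are n * (n^2 / eps + 1) * (C + 1) entries, each
    computed by trying at most Q + 1 levels, which gives the time bound
    ([fptas_time]).

    The program is verified in a small logic of total correctness with time
    bounds ([runs]).  Its specification speaks of functions on natural numbers
    instead of solutions: an item is mapped to 0 if it is left out and to l + 1
    if it is packed at level l.  Telescoping the increments of weight and cost
    identifies nested assignments with such functions ([codes_total_weight],
    [codes_total_icost], [nested_codes]). *)

(** * Timed total correctness *)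

Section Runs.
Variable R : archiRealFieldType.
Implicit Types (st : state R) (c : cmd) (Q : state R -> Prop) (T : nat).

(** The time is only bounded from above: the branches of a conditional and the
    rounds of a loop can then share one bound, while the rules for the other
    commands give bounds that are read off the syntax. *)
Definition runs c st Q T : Prop :=
  exists st' t, [/\ exec c st st' t, (t <= T)%N & Q st'].

Lemma runs_le c st Q T T' : runs c st Q T -> (T <= T')%N -> runs c st Q T'.
Proof.
by move=> [st' [t [ex tT Qst']]] TT'; exists st', t; rewrite (leq_trans tT).
Qed.

Lemma runs_post c st Q Q' T :
  (forall st', Q st' -> Q' st') -> runs c st Q T -> runs c st Q' T.
Proof. by move=> QQ' [st' [t [ex tT /QQ' Qst']]]; exists st', t. Qed.

Lemma runs_skip st Q : Q st -> runs Skip st Q 0.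
Proof. by move=> Qst; exists st, 0%N; split=> //; constructor. Qed.

Lemma runs_assign v e st Q :
  Q (set_var st v (eval st e)) -> runs (Assign v e) st Q (expr_time e).+1.
Proof. by move=> Qst; do 2!eexists; split; [constructor | | exact: Qst]. Qed.

Lemma runs_write a e1 e2 e st Q :
  Q (set_arr st a (Num.truncn (eval st e1)) (Num.truncn (eval st e2))
       (eval st e)) ->
  runs (Write a e1 e2 e) st Q (expr_time e1 + expr_time e2 + expr_time e).+1.
Proof. by move=> Qst; do 2!eexists; split; [constructor | | exact: Qst]. Qed.

Lemma runs_seq c1 c2 st Q T1 T2 :
  runs c1 st (fun st1 => runs c2 st1 Q T2) T1 -> runs (Seq c1 c2) st Q (T1 + T2).
Proof.
move=> [st1 [t1 [ex1 t1T [st2 [t2 [ex2 t2T Qst2]]]]]].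
by exists st2, (t1 + t2)%N; split; [exact: ExecSeq ex1 ex2 | exact: leq_add |].
Qed.

Lemma runs_if b c1 c2 st Q T1 T2 :
  (holds st b -> runs c1 st Q T1) -> (~~ holds st b -> runs c2 st Q T2) ->
  runs (If b c1 c2) st Q (test_time b + maxn T1 T2).
Proof.
case: (boolP (holds st b)) => hb.
  move=> /(_ isT) [st' [t [ex tT Qst']]] _; do 2!eexists.
  by split; [exact: ExecIfT ex | rewrite leq_add2l leq_max tT | exact: Qst'].
move=> _ /(_ isT) [st' [t [ex tT Qst']]]; do 2!eexists.
by split; [exact: ExecIfF ex | rewrite leq_add2l leq_max tT orbT | exact: Qst'].
Qed.

Fixpoint written_vars c : seq nat :=
  match c with
  | Assign v _ => [:: v]
  | Seq c1 c2 | If _ c1 c2 => written_vars c1 ++ written_vars c2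
  | While _ c1 => written_vars c1
  | Skip | Write _ _ _ _ => [::]
  end.

Fixpoint written_arrs c : seq nat :=
  match c with
  | Write a _ _ _ => [:: a]
  | Seq c1 c2 | If _ c1 c2 => written_arrs c1 ++ written_arrs c2
  | While _ c1 => written_arrs c1
  | Skip | Assign _ _ => [::]
  end.

Definition agree_off (vs ars : seq nat) st st' : Prop :=
  (forall v, v \notin vs -> var st' v = var st v) /\
  (forall a, a \notin ars -> forall r k, arr st' a r k = arr st a r k).

Lemma agree_off_refl vs ars st : agree_off vs ars st st.
Proof. by split. Qed.

Lemma agree_off_trans vs ars st1 st2 st3 :
  agree_off vs ars st1 st2 -> agree_off vs ars st2 st3 ->
  agree_off vs ars st1 st3.
Proof.
move=> [v12 a12] [v23 a23]; split=> [v hv | a ha r k].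
  by rewrite v23 // v12.
by rewrite a23 // a12.
Qed.

Lemma agree_off_sub vs ars vs' ars' st st' :
  {subset vs <= vs'} -> {subset ars <= ars'} ->
  agree_off vs ars st st' -> agree_off vs' ars' st st'.
Proof.
move=> sv sa [hv ha]; split=> u hu; [apply: hv | apply: ha].
  by apply: contra hu => /sv.
by apply: contra hu => /sa.
Qed.

Lemma exec_agree c st st' t :
  exec c st st' t -> agree_off (written_vars c) (written_arrs c) st st'.
Proof.
have L (s1 s2 : seq nat) : {subset s1 <= s1 ++ s2}.
  by move=> x xs; rewrite mem_cat xs.
have M (s1 s2 : seq nat) : {subset s2 <= s1 ++ s2}.
  by move=> x xs; rewrite mem_cat xs orbT.
elim=> {c st st' t} /=.
- by move=> *; exact: agree_off_refl.
- move=> st v e; split=> // u /=; by rewrite inE => /negPf ->.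
- move=> st a e1 e2 e; split=> // b /=; by rewrite inE => /negPf ->.
- move=> c1 c2 st st1 st2 t1 t2 _ IH1 _ IH2.
  by apply: agree_off_trans (agree_off_sub _ _ IH1) (agree_off_sub _ _ IH2).
- by move=> b c1 c2 st st' t _ _; exact: agree_off_sub.
- by move=> b c1 c2 st st' t _ _; exact: agree_off_sub.
- by move=> *; exact: agree_off_refl.
- move=> b c st st1 st2 t1 t2 _ _ IH1 _ IH2; exact: agree_off_trans IH1 IH2.
Qed.

(** Framing for free: what a command does not mention as a target survives it,
    so specifications need only speak of what changes. *)
Lemma runs_agree c st Q T :
  runs c st Q T ->
  runs c st (fun st' =>
    Q st' /\ agree_off (written_vars c) (written_arrs c) st st') T.
Proof.
move=> [st' [t [ex tT Qst']]]; exists st', t; split=> //.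
by split=> //; exact: exec_agree ex.
Qed.

Definition For (v b : nat) (c : cmd) : cmd :=
  Seq (Assign v (Lit 0))
      (While (Lt (Var v) (Var b)) (Seq c (Assign v (Add (Var v) (Lit 1))))).

(** The hypothesis on the body includes the frame of the whole loop, so that an
    invariant mentions only the memory that the loop writes.  A round costs one
    test and two operations for the counter besides its body. *)
Lemma runs_for (Inv : nat -> state R -> Prop) v b c st N T :
  var st b = N%:R -> b \notin v :: written_vars c -> v \notin written_vars c ->
  Inv 0%N (set_var st v 0) ->
  (forall k st', (k < N)%N ->
     agree_off (v :: written_vars c) (written_arrs c) st st' ->
     var st' v = k%:R -> Inv k st' ->
     runs c st' (fun st'' => Inv k.+1 (set_var st'' v k.+1%:R)) T) ->
  runs (For v b c) st (fun st' =>
    Inv N st' /\ agree_off (v :: written_vars c) (written_arrs c) st st')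
    (N * (T + 3) + 2).
Proof.
move=> bN bv vc Inv0 InvS.
pose agr := agree_off (v :: written_vars c) (written_arrs c).
have upd st1 x : agr st1 (set_var st1 v x).
  by split=> // u /=; rewrite inE negb_or => /andP[/negPf ->].
suff loop m : forall k st1, (m + k = N)%N -> agr st st1 -> var st1 v = k%:R ->
    Inv k st1 ->
    runs (While (Lt (Var v) (Var b)) (Seq c (Assign v (Add (Var v) (Lit 1)))))
      st1 (fun st' => Inv N st' /\ agr st st') (m * (T + 3) + 1).
  have -> : (N * (T + 3) + 2 = (expr_time (Lit 0)).+1 + (N * (T + 3) + 1))%N.
    by rewrite /=; lia.
  apply: runs_seq; apply: runs_assign; apply: (loop N 0%N) => //.
  - by rewrite addn0.
  - by rewrite /= eqxx.
elim: m => [|m IH] k st1 mkN ag vk Ik.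
  exists st1, 1%N; split=> //; last by rewrite -mkN.
  apply: (@ExecWhileF R (Lt (Var v) (Var b))).
  by rewrite /= vk (ag.1 b bv) bN -mkN ltxx.
have kN : (k < N)%N by lia.
have [st2 [t2 [ex2 t2T [Ik2 ag2]]]] := runs_agree (InvS k st1 kN ag vk Ik).
have v2 : var st2 v = k%:R by rewrite (ag2.1 v vc).
have e2 : var st2 v + 1 = k.+1%:R by rewrite v2 -natr1.
have ag12 : agr st1 st2.
  by apply: agree_off_sub ag2 => // x xs; rewrite inE xs orbT.
have [||||st3 [t3 [ex3 t3T [I3 ag3]]]] :=
  IH k.+1 (set_var st2 v (var st2 v + 1)).
- by rewrite addnS -addSn.
- exact: agree_off_trans (agree_off_trans ag ag12) (upd _ _).
- by rewrite /= eqxx.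
- by rewrite e2.
exists st3, (1 + (t2 + 2) + t3)%N; split=> //; last by lia.
apply: (@ExecWhileT R (Lt (Var v) (Var b)) _ _ (set_var st2 v (var st2 v + 1))) ex3.
  by rewrite /= vk (ag.1 b bv) bN ltr_nat.
apply: ExecSeq ex2 _.
exact: (@ExecAssign R st2 v (Add (Var v) (Lit 1))).
Qed.

End Runs.

(** * Minimum weight for a given profit and cost *)

Section MinWeight.
Variables (R : realDomainType) (big : R) (w : nat -> nat -> R).
Variables (g : nat -> nat -> nat) (q lv : nat -> nat).
Implicit Types (T : nat -> nat -> R) (f : nat -> nat).

(** A decision about an item is a number: 0 leaves the item out, and [l.+1]
    packs it at level [l]. *)
Definition weight_of i d : R := if d is l.+1 then w i l else 0.
Definition cost_of i d : nat := if d is l.+1 then g i l else 0%N.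
Definition gain_of i d : nat := if d is _.+1 then q i else 0%N.

(** [T] plays the role of the table for the items before [i].  Truncated
    subtraction in [P - q i] is intended: it asks for gain at least [P], which
    keeps the required gains within the range of the table. *)
Fixpoint select T i P c m : R * nat :=
  if m is l.+1 then
    let ad := select T i P c l in
    if (g i l <= c)%N && (w i l + T (P - q i)%N (c - g i l)%N < ad.1)
    then (w i l + T (P - q i)%N (c - g i l)%N, l.+1) else ad
  else (T P c, 0%N).

Lemma select_le T i P c m d : (d <= m)%N -> (cost_of i d <= c)%N ->
  (select T i P c m).1
    <= weight_of i d + T (P - gain_of i d)%N (c - cost_of i d)%N.
Proof.
elim: m => [|m IH]; first by case: d => //= _ _; rewrite add0r !subn0.
rewrite leq_eqVlt => /predU1P[-> /= cc|dm cc] /=.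
  by rewrite cc /=; case: ltP.
apply: le_trans (IH dm cc); by case: ifP => //= /andP[_ /ltW].
Qed.

Lemma select_attained T i P c m (d := (select T i P c m).2) :
  [/\ (d <= m)%N, (cost_of i d <= c)%N &
    (select T i P c m).1
      = weight_of i d + T (P - gain_of i d)%N (c - cost_of i d)%N].
Proof.
rewrite {}/d; elim: m => [|m [dm cc e]] /=; first by rewrite add0r !subn0.
by case: ifP => [/andP[cm _]|_]; split=> //=; exact: leqW.
Qed.

(** The value [big] marks a positive gain that no item is left to supply; it is
    later taken above the knapsack budget. *)
Fixpoint min_weight i : nat -> nat -> R :=
  if i is j.+1 then fun P c => (select (min_weight j) j P c (lv j).+1).1
  else fun P _ => if P is 0 then 0 else big.

Definition choice i P c : nat := (select (min_weight i) i P c (lv i).+1).2.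

Lemma min_weight_le n f P c :
  (forall i, (i < n)%N -> (f i <= (lv i).+1)%N) ->
  (P <= \sum_(i < n) gain_of i (f i))%N ->
  (\sum_(i < n) cost_of i (f i) <= c)%N ->
  min_weight n P c <= \sum_(i < n) weight_of i (f i).
Proof.
elim: n P c => [|n IH] P c fP; first by rewrite !big_ord0 leqn0 => /eqP ->.
rewrite !big_ord_recr /= => Pq cc.
have cn : (cost_of n (f n) <= c)%N by lia.
apply: le_trans (select_le _ _ (fP n _) cn) _ => //.
rewrite addrC; apply: lerD => //; apply: IH => [i iN||].
- by apply/fP/ltnW.
- by rewrite leq_subLR addnC.
- by rewrite leq_subRL // addnC.
Qed.

End MinWeight.
(** * The program *)

(* Variables 0 to 3 and arrays 0 to 3 hold the input, arrays 4 and 5 the output.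
   Both tables are indexed by (item, column), where the column P * (C + 1) + c
   stands for the pair of the required gain P and the cost allowance c. *)

Local Notation vN := 0%N (only parsing).
Local Notation vB := 1%N (only parsing).
Local Notation vC := 2%N (only parsing).
Local Notation vEps := 3%N (only parsing).
Local Notation vI := 4%N (only parsing).
Local Notation vL := 5%N (only parsing).
Local Notation vMax := 6%N (only parsing).
Local Notation vK := 7%N (only parsing).
Local Notation vP := 8%N (only parsing).
Local Notation vCost := 9%N (only parsing).
Local Notation vQ := 10%N (only parsing).
Local Notation vAcc := 11%N (only parsing).
Local Notation vD := 12%N (only parsing).
Local Notation vRows := 13%N (only parsing).
Local Notation vCols := 14%N (only parsing).
Local Notation vBase := 15%N (only parsing).
Local Notation vCand := 16%N (only parsing).
Local Notation vBest := 17%N (only parsing).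
Local Notation vLim := 18%N (only parsing).
Local Notation vCells := 19%N (only parsing).
Local Notation vJ := 20%N (only parsing).
Local Notation aProfit := 0%N (only parsing).
Local Notation aLevels := 1%N (only parsing).
Local Notation aWeight := 2%N (only parsing).
Local Notation aCost := 3%N (only parsing).
Local Notation aX := 4%N (only parsing).
Local Notation aY := 5%N (only parsing).
Local Notation aTable := 6%N (only parsing).
Local Notation aChoice := 7%N (only parsing).

Definition count_levels : cmd :=
  Assign vLim (Add (Read aLevels (Var vI) (Lit 0)) (Lit 1)).

Definition scan_item : cmd :=
  If (Le (Read aWeight (Var vI) (Var vL)) (Var vB))
    (If (Le (Read aCost (Var vI) (Var vL)) (Var vC))
       (If (Lt (Var vMax) (Read aProfit (Var vI) (Lit 0)))
          (Assign vMax (Read aProfit (Var vI) (Lit 0))) Skip) Skip) Skip.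

Definition find_max : cmd :=
  Seq (Assign vMax (Lit 0))
      (For vI vN (Seq count_levels (For vL vLim scan_item))).

Definition scale_profit : cmd :=
  Assign vQ (Floor (Div (Mul (Read aProfit (Var vI) (Lit 0)) (Var vN))
                        (Mul (Var vEps) (Var vMax)))).

Definition table_size : cmd :=
  Seq (Assign vRows (Add (Floor (Div (Mul (Var vN) (Var vN)) (Var vEps))) (Lit 1)))
  (Seq (Assign vCols (Add (Var vC) (Lit 1)))
       (Assign vCells (Mul (Var vRows) (Var vCols)))).

Definition fill_base : cmd :=
  For vK vCells
    (If (Lt (Var vK) (Var vCols))
       (Write aTable (Lit 0) (Var vK) (Lit 0))
       (Write aTable (Lit 0) (Var vK) (Add (Var vB) (Lit 1)))).

Definition reduce_profit (v : nat) : cmd :=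
  If (Le (Var vQ) (Var vP)) (Assign v (Defs.Sub (Var vP) (Var vQ))) (Assign v (Lit 0)).

Definition try_level : cmd :=
  If (Le (Read aCost (Var vI) (Var vL)) (Var vCost))
    (Seq (Assign vCand
            (Add (Read aWeight (Var vI) (Var vL))
                 (Read aTable (Var vI)
                    (Add (Mul (Var vBase) (Var vCols))
                         (Defs.Sub (Var vCost) (Read aCost (Var vI) (Var vL)))))))
         (If (Lt (Var vCand) (Var vAcc))
            (Seq (Assign vAcc (Var vCand)) (Assign vD (Add (Var vL) (Lit 1))))
            Skip))
    Skip.

Definition fill_cell : cmd :=
  Seq (Assign vP (Floor (Div (Var vK) (Var vCols))))
  (Seq (Assign vCost (Defs.Sub (Var vK) (Mul (Var vP) (Var vCols))))
  (Seq (reduce_profit vBase)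
  (Seq (Assign vAcc (Read aTable (Var vI) (Var vK)))
  (Seq (Assign vD (Lit 0))
  (Seq (For vL vLim try_level)
  (Seq (Write aTable (Add (Var vI) (Lit 1)) (Var vK) (Var vAcc))
       (Write aChoice (Var vI) (Var vK) (Var vD)))))))).

Definition fill_table : cmd :=
  For vI vN (Seq scale_profit (Seq count_levels (For vK vCells fill_cell))).

Definition find_best : cmd :=
  Seq (Assign vBest (Lit 0))
      (For vP vRows
         (If (Le (Read aTable (Var vN) (Add (Mul (Var vP) (Var vCols)) (Var vC)))
                 (Var vB))
            (Assign vBest (Var vP)) Skip)).

Definition write_levels : cmd :=
  For vL vLim
    (If (Lt (Var vL) (Var vD)) (Write aY (Var vI) (Var vL) (Lit 1))
                               (Write aY (Var vI) (Var vL) (Lit 0))).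

Definition trace_item : cmd :=
  Seq (Assign vI (Defs.Sub (Defs.Sub (Var vN) (Lit 1)) (Var vJ)))
  (Seq scale_profit
  (Seq count_levels
  (Seq (Assign vD (Read aChoice (Var vI)
                     (Add (Mul (Var vP) (Var vCols)) (Var vCost))))
  (Seq (If (Lt (Lit 0) (Var vD))
          (Seq (Write aX (Var vI) (Lit 0) (Lit 1))
          (Seq (Assign vCost
                  (Defs.Sub (Var vCost) (Read aCost (Var vI) (Defs.Sub (Var vD) (Lit 1)))))
               (reduce_profit vP)))
          (Write aX (Var vI) (Lit 0) (Lit 0)))
       write_levels)))).

Definition trace_back : cmd :=
  Seq (Assign vP (Var vBest))
  (Seq (Assign vCost (Var vC))
       (For vJ vN trace_item)).

Definition fptas : cmd :=
  Seq find_max (Seq table_size (Seq fill_base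
  (Seq fill_table (Seq find_best trace_back)))).

(** * Correctness of the program *)

Section Program.
Variables (R : archiRealFieldType) (n C Q : nat) (B eps : R).
Variables (p : nat -> R) (lv : nat -> nat) (w : nat -> nat -> R).
Variable g : nat -> nat -> nat.
Hypotheses (p_ge0 : forall i, (i < n)%N -> 0 <= p i).
Hypotheses (w_ge0 : forall i l, (i < n)%N -> (l <= lv i)%N -> 0 <= w i l).
Hypotheses (B_ge0 : 0 <= B) (eps_gt0 : 0 < eps).
Hypothesis lvQ : forall i, (i < n)%N -> (lv i <= Q)%N.
Implicit Types (st : state R).

Record input st : Prop := Input {
  input_n   : var st vN = n%:R;
  input_B   : var st vB = B;
  input_C   : var st vC = C%:R;
  input_eps : var st vEps = eps;
  input_p   : forall i, (i < n)%N -> arr st aProfit i 0 = p i;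
  input_lv  : forall i, (i < n)%N -> arr st aLevels i 0 = (lv i)%:R;
  input_w   : forall i l, (i < n)%N -> (l <= lv i)%N -> arr st aWeight i l = w i l;
  input_g   : forall i l, (i < n)%N -> (l <= lv i)%N ->
                arr st aCost i l = (g i l)%:R }.

Lemma input_agree vs ars st st' :
  agree_off vs ars st st' -> all (leq 4) vs -> all (leq 4) ars ->
  input st -> input st'.
Proof.
move=> [hv ha] /allP lvs /allP lars [i0 i1 i2 i3 i4 i5 i6 i7].
have V v : (v < 4)%N -> var st' v = var st v.
  by move=> v4; apply: hv; apply/negP => /lvs; rewrite leqNgt v4.
have A a : (a < 4)%N -> forall r k, arr st' a r k = arr st a r k.
  by move=> a4; apply: ha; apply/negP => /lars; rewrite leqNgt a4.
by split=> *; rewrite ?V ?A //; auto.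
Qed.

Lemma runs_count_levels st i (P : state R -> Prop) :
  input st -> (i < n)%N -> var st vI = i%:R ->
  P (set_var st vLim (lv i).+1%:R) -> runs count_levels st P 3.
Proof.
move=> inp lt_in vi Pst; apply: runs_assign.
by rewrite /= vi !natrK (input_lv inp) // natr1.
Qed.

(** Both halves matter: the upper bound keeps gains at most n / eps, and
    attainment makes [m] a lower bound for the optimum.  [D] delimits the pairs
    (item, level) that have been scanned so far. *)
Definition max_fitting (D : nat -> nat -> bool) (m : R) : Prop :=
  [/\ 0 <= m,
      forall i l, (i < n)%N -> (l <= lv i)%N -> D i l ->
        w i l <= B -> (g i l <= C)%N -> p i <= m
    & m = 0 \/ exists i l, [/\ (i < n)%N, (l <= lv i)%N, w i l <= B,
        (g i l <= C)%N & m = p i]].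

Lemma runs_find_max st : input st ->
  runs find_max st (fun st' => max_fitting (fun _ _ => true) (var st' vMax))
    (1 + (n * (3 + (Q.+1 * (8 + 3) + 2) + 3) + 2)).
Proof.
move=> inp; apply: runs_seq; apply: runs_assign.
pose Inv k st' := max_fitting (fun i _ => i < k)%N (var st' vMax).
apply: (runs_post (Q := fun st' => Inv n st' /\ _)); last first.
  apply: (runs_for (Inv := Inv)) => //; first by rewrite /= (input_n inp).
    by split=> //; left.
  move=> i st1 lt_in ag vi Ii.
  have inp1 : input st1 by apply: input_agree ag _ _ _ => //; case: inp.
  apply: runs_seq; apply: (runs_count_levels inp1 lt_in vi).
  pose Inv' k st' := max_fitting (fun i' l =>
    (i' < i) || (i' == i) && (l < k))%N (var st' vMax).
  apply: (@runs_le _ _ _ _ ((lv i).+1 * (8 + 3) + 2)); last first.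
    by have := lvQ lt_in; lia.
  apply: (runs_post (Q := fun st' => Inv' (lv i).+1 st' /\ _)); last first.
    apply: (runs_for (Inv := Inv')) => //.
      case: Ii => h1 h2 h3; split=> // i' l lt ll; rewrite ltn0 andbF orbF.
      exact: h2.
    move=> l st2 lt_l ag2 vl [m0 mU mE].
    have inp2 : input st2.
      by apply: input_agree ag2 _ _ _ => //; case: inp1.
    have vi2 : var st2 vI = i%:R by rewrite ag2.1 //=.
    rewrite ltnS in lt_l.
    have keep : (w i l <= B -> (g i l <= C)%N -> p i <= var st2 vMax) ->
      Inv' l.+1 (set_var st2 vL l.+1%:R).
      move=> le_m; split=> //= i' l' lt' ll'.
      case/orP => [lt_i|/andP[/eqP e]]; first by apply: mU; rewrite ?lt_i.
      rewrite e in ll' *; rewrite ltnS leq_eqVlt => /predU1P[-> //|lt_l'].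
      by apply: mU; rewrite // eqxx lt_l' orbT.
    eapply runs_le.
      apply: runs_if => /=; last first.
        rewrite vi2 vl !natrK (input_w inp2) // (input_B inp2) => /negP hw.
        by apply: runs_skip; apply: keep.
      rewrite vi2 vl !natrK (input_w inp2) // (input_B inp2) => hw.
      apply: runs_if => /=; last first.
        rewrite vi2 vl !natrK (input_g inp2) // (input_C inp2) ler_nat => /negP hc.
        by apply: runs_skip; apply: keep.
      rewrite vi2 vl !natrK (input_g inp2) // (input_C inp2) ler_nat => hc.
      apply: runs_if => /=; last first.
        rewrite vi2 !natrK (input_p inp2) // -leNgt => hp.
        by apply: runs_skip; apply: keep.
      rewrite vi2 !natrK (input_p inp2) // => hp.
      apply: runs_assign; split=> /=.
      - by rewrite vi2 !natrK (input_p inp2) // p_ge0.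
      - move=> i' l' lt' ll'; rewrite vi2 !natrK (input_p inp2) //.
        case/orP => [lt_i|/andP[/eqP -> _ _ _ //]].
        move=> hw' hc'; apply: le_trans (ltW hp).
        by apply: mU hw' hc'; rewrite ?lt_i.
      - by right; exists i, l; rewrite vi2 !natrK (input_p inp2).
    by [].
  move=> st2 [[m0 mU mE] _]; split=> //= i' l lt' ll'.
  rewrite ltnS leq_eqVlt => h; apply: mU => //.
  by case/predU1P: h ll' => [->|->] // ll'; rewrite eqxx ltnS ll' orbT.
move=> st1 [[m0 mU mE] _]; split=> // i l lt_in ll _.
exact: mU.
Qed.


Lemma floor_nat (x : R) : 0 <= x -> (Num.floor x)%:~R = (Num.truncn x)%:R :> R.
Proof.
by move=> x0; rewrite truncn_floor x0 natr_absz ger0_norm // floor_ge0.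
Qed.

Lemma floor_divn (k d : nat) : (0 < d)%N ->
  (Num.floor (k%:R / d%:R : R))%:~R = (k %/ d)%N%:R :> R.
Proof.
move=> d0; rewrite floor_nat ?divr_ge0 ?ler0n //; congr (_%:R).
apply: truncn_def; rewrite ler_pdivlMr ?ltr0n // ltr_pdivrMr ?ltr0n //.
by rewrite -!natrM ler_nat ltr_nat leq_divM ltn_ceil.
Qed.

Definition max_gain : nat := Num.truncn (n%:R * n%:R / eps).
Definition cells : nat := (max_gain.+1 * C.+1)%N.

Record sized st : Prop := Sized {
  sized_rows  : var st vRows = max_gain.+1%:R;
  sized_cols  : var st vCols = C.+1%:R;
  sized_cells : var st vCells = cells%:R }.

Lemma sized_agree vs ars st st' : agree_off vs ars st st' ->
  ~~ has (mem [:: vRows; vCols; vCells]) vs -> sized st -> sized st'.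
Proof.
move=> [hv _] /hasPn nvs [s1 s2 s3].
by split; rewrite hv //; apply: contraT => /negPn /nvs.
Qed.

Lemma runs_table_size st : input st -> runs table_size st sized 9.
Proof.
move=> inp; apply: (@runs_le _ _ _ _ (5 + (2 + 2))) => //.
do 2![apply: runs_seq; apply: runs_assign]; apply: runs_assign.
rewrite /= (input_n inp) (input_eps inp) (input_C inp) !natr1.
rewrite floor_nat; last by rewrite divr_ge0 ?mulr_ge0 ?ler0n // ltW.
by split=> //=; rewrite natr1 // -natrM.
Qed.

Lemma column_lt P c :
  (P <= max_gain)%N -> (c <= C)%N -> (P * C.+1 + c < cells)%N.
Proof.
move=> leP lec; apply: (@leq_trans (P.+1 * C.+1)).
  by rewrite mulSn addnC ltn_add2r.
by rewrite leq_mul2r ltnS leP orbT.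
Qed.

Section Table.
Variable m : R.
Hypothesis m_ge0 : 0 <= m.

(** If [m] is 0, then so is the quotient, and all gains vanish. *)
Definition gain i : nat := Num.truncn (p i * n%:R / (eps * m)).

Lemma runs_scale_profit st i (P : state R -> Prop) :
  input st -> (i < n)%N -> var st vI = i%:R -> var st vMax = m ->
  P (set_var st vQ (gain i)%:R) -> runs scale_profit st P 6.
Proof.
move=> inp lt_in vi vm Pst; apply: runs_assign.
rewrite /= vi !natrK (input_p inp) // (input_n inp) (input_eps inp) vm.
by rewrite floor_nat // divr_ge0 ?mulr_ge0 ?ler0n ?p_ge0 // ltW.
Qed.

Lemma runs_reduce_profit v st (P d : nat) (Post : state R -> Prop) :
  var st vP = P%:R -> var st vQ = d%:R ->
  Post (set_var st v (P - d)%N%:R) -> runs (reduce_profit v) st Post 3.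
Proof.
move=> valP valQ Pst; apply: (@runs_le _ _ _ _ (1 + maxn 2 1)) => //.
apply: runs_if; rewrite /= valP valQ ler_nat => h; apply: runs_assign => /=.
  by rewrite valP valQ -natrB.
suff -> : 0%:R = (P - d)%N%:R :> R by [].
by congr (_%:R); apply/esym/eqP; rewrite subn_eq0 ltnW // ltnNge.
Qed.

Local Notation mw := (min_weight (B + 1) w g gain lv).

Definition entry i k : R := mw i (k %/ C.+1)%N (k %% C.+1)%N.
Definition best_level i k : nat :=
  choice (B + 1) w g gain lv i (k %/ C.+1)%N (k %% C.+1)%N.

Lemma column_divn P c : (c <= C)%N -> ((P * C.+1 + c) %/ C.+1 = P)%N.
Proof. by move=> lec; rewrite divnMDl // divn_small // addn0. Qed.

Lemma column_modn P c : (c <= C)%N -> ((P * C.+1 + c) %% C.+1 = c)%N.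
Proof. by move=> lec; rewrite modnMDl modn_small. Qed.

Definition table_row i st : Prop :=
  forall k, (k < cells)%N -> arr st aTable i k = entry i k.
Definition choice_row i st : Prop :=
  forall k, (k < cells)%N -> arr st aChoice i k = (best_level i k)%:R.

Lemma runs_fill_base st : input st -> sized st ->
  runs fill_base st (table_row 0) (cells * (3 + 3) + 2).
Proof.
move=> inp sz.
pose Inv j st' := forall k, (k < j)%N -> arr st' aTable 0 k = entry 0 k.
apply: (runs_post (Q := fun st' => Inv cells st' /\ _)); first by move=> ? [].
apply: (runs_for (Inv := Inv)) => //; first exact: sized_cells.
move=> j st1 lt_j ag vj Ij.
have inp1 : input st1 by apply: input_agree ag _ _ inp.
have sz1 : sized st1 by apply: sized_agree ag _ sz.
have P0 : (j < C.+1)%N = (j %/ C.+1 == 0)%N.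
  by rewrite -leqn0 -[RHS]ltnS ltn_divLR ?mul1n.
have new x : x = entry 0 j ->
    Inv j.+1 (set_var (set_arr st1 aTable 0 j x) vK j.+1%:R).
  move=> -> k; rewrite ltnS leq_eqVlt => /predU1P[->|lt_k] /=.
    by rewrite eqxx.
  by rewrite (ltn_eqF lt_k) Ij.
apply: (@runs_le _ _ _ _ (1 + maxn 1 2)) => //.
apply: runs_if => /=; rewrite vj (sized_cols sz1) ltr_nat P0 => h;
  apply: runs_write; rewrite /= vj !natrK; apply: new; rewrite /entry /=.
  by rewrite (eqP h).
by rewrite (input_B inp1); case: (j %/ C.+1)%N h.
Qed.

(** One cell costs a constant plus a constant per level.  The cells it reads
    are all in row [i], the row before the one it writes. *)
Lemma runs_fill_cell st i k :
  input st -> sized st -> (i < n)%N -> (k < cells)%N ->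
  var st vI = i%:R -> var st vK = k%:R ->
  var st vQ = (gain i)%:R -> var st vLim = (lv i).+1%:R -> table_row i st ->
  runs fill_cell st (fun st' =>
     (forall i' k', arr st' aTable i' k' =
        if (i' == i.+1) && (k' == k) then entry i.+1 k else arr st aTable i' k')
  /\ (forall i' k', arr st' aChoice i' k' =
        if (i' == i) && (k' == k) then (best_level i k)%:R
        else arr st aChoice i' k'))
    (16 + (Q.+1 * (14 + 3) + 2)).
Proof.
move=> inp sz lt_in lt_k vi vk vq vl row.
pose P := (k %/ C.+1)%N; pose c := (k %% C.+1)%N.
have lt_P : (P < max_gain.+1)%N by rewrite ltn_divLR.
have lt_c : (c < C.+1)%N by rewrite ltn_mod.
eapply runs_le.
  apply: runs_seq; apply: runs_assign.
  rewrite [eval _ _]/= vk (sized_cols sz) floor_divn // -/P.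
  apply: runs_seq; apply: runs_assign.
  have -> : eval (set_var st vP P%:R) (Defs.Sub (Var vK) (Mul (Var vP) (Var vCols)))
      = c%:R.
    rewrite /= vk (sized_cols sz) -natrM -natrB ?leq_divM //.
    by congr (_%:R); rewrite {1}(divn_eq k C.+1) addKn.
  apply: runs_seq.
  apply: (@runs_reduce_profit _ _ P (gain i)) => //.
  apply: runs_seq; apply: runs_assign.
  rewrite [eval _ _]/= vi vk !natrK row //.
  apply: runs_seq; apply: runs_assign; rewrite [eval _ _]/=.
  apply: runs_seq.
  set st0 := (X in runs _ X).
  pose sel l := select w g gain (mw i) i P c l.
  pose Inv l st' := var st' vAcc = (sel l).1 /\ var st' vD = (sel l).2%:R.
  apply: (@runs_le _ _ _ _ ((lv i).+1 * (14 + 3) + 2)); last first.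
    have le_lvQ : ((lv i).+1 * (14 + 3) + 2 <= Q.+1 * (14 + 3) + 2)%N.
      by rewrite leq_add2r leq_mul2r ltnS lvQ ?orbT.
    exact: le_lvQ.
  apply: (runs_post (Q := fun st' => Inv (lv i).+1 st' /\ _)); last first.
    apply: (runs_for (Inv := Inv)) => //.
    move=> l st1; rewrite ltnS => lt_l ag vl1 [acc1 d1].
    have inp1 : input st1.
      by apply: input_agree ag _ _ _ => //; case: inp.
    have vi1 : var st1 vI = i%:R by rewrite ag.1.
    have vc1 : var st1 vCost = c%:R by rewrite ag.1.
    have vb1 : var st1 vBase = (P - gain i)%N%:R by rewrite ag.1.
    have vw1 : var st1 vCols = C.+1%:R.
      by rewrite ag.1 //= (sized_cols sz).
    have row1 : table_row i st1.
      by move=> k' lt_k'; rewrite ag.2 // row.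
    have keep : sel l.+1 = sel l -> Inv l.+1 (set_var st1 vL l.+1%:R).
      by move=> e; split; rewrite e.
    eapply runs_le.
      apply: runs_if => /=; rewrite vi1 vl1 vc1 !natrK (input_g inp1) // ler_nat;
        last first.
        by move=> /negPf hc; apply: runs_skip; apply: keep; rewrite /sel /= hc.
      move=> hc.
      apply: runs_seq; apply: runs_assign.
      rewrite [eval _ _]/= vi1 vl1 vc1 vb1 vw1 !natrK (input_g inp1) //.
      have le_P : (P - gain i <= max_gain)%N by rewrite (leq_trans (leq_subr _ _)).
      have le_c : (c - g i l <= C)%N by rewrite (leq_trans (leq_subr _ _)).
      rewrite (input_w inp1) // -natrB // -natrM -natrD natrK row1 ?column_lt //.
      rewrite /entry column_divn // column_modn //.
      apply: runs_if => /=; rewrite acc1 => h; last first.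
        apply: runs_skip; split; rewrite /= /sel /= hc /= (negPf h) //.
      apply: runs_seq; apply: runs_assign; apply: runs_assign.
      by split; rewrite /= /sel /= hc /= h //= vl1 natr1.
    by [].
  move=> st1 [[acc1 d1] ag].
  have vi1 : var st1 vI = i%:R by rewrite ag.1.
  have vk1 : var st1 vK = k%:R by rewrite ag.1.
  apply: runs_seq; apply: runs_write.
  rewrite /= vi1 vk1 natr1 !natrK acc1.
  apply: runs_write; rewrite /= vi1 vk1 !natrK d1.
  by split=> i' k' /=; case: ifP => // _; rewrite ag.2.
by rewrite /=; lia.
Qed.

Lemma runs_fill_table st :
  input st -> sized st -> var st vMax = m -> table_row 0 st ->
  runs fill_table st (fun st' =>
      table_row n st' /\ (forall i, (i < n)%N -> choice_row i st'))
    (n * (6 + (3 + (cells * (16 + (Q.+1 * (14 + 3) + 2) + 3) + 2)) + 3) + 2).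
Proof.
move=> inp sz vm row0.
pose Inv i st' := table_row i st' /\ (forall i', (i' < i)%N -> choice_row i' st').
apply: (runs_post (Q := fun st' => Inv n st' /\ _)); first by move=> ? [].
apply: (runs_for (Inv := Inv)) => //; first exact: input_n.
move=> i st1 lt_in ag vi [row ch].
have inp1 : input st1 by apply: input_agree ag _ _ inp.
have sz1 : sized st1 by apply: sized_agree ag _ sz.
have vm1 : var st1 vMax = m by rewrite ag.1.
apply: runs_seq; apply: (runs_scale_profit inp1 lt_in vi vm1).
have inp2 : input (set_var st1 vQ (gain i)%:R) by case: inp1.
apply: runs_seq; apply: (runs_count_levels inp2 lt_in) => //.
pose Inv' j st' := [/\ table_row i st',
  forall k, (k < j)%N -> arr st' aTable i.+1 k = entry i.+1 k,
  forall i', (i' < i)%N -> choice_row i' st' &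
  forall k, (k < j)%N -> arr st' aChoice i k = (best_level i k)%:R].
apply: (runs_post (Q := fun st' => Inv' cells st' /\ _)).
  move=> st2 [[_ t2 c1 c2] _]; split=> // i'.
  by rewrite ltnS leq_eqVlt => /predU1P[->|] //; exact: c1.
apply: (runs_for (Inv := Inv')) => //; first exact: (sized_cells sz1).
move=> k st2 lt_k ag2 vk [t1 t2 c1 c2].
have inp3 : input st2 by apply: input_agree ag2 _ _ _ => //; case: inp1.
have sz2 : sized st2 by apply: sized_agree ag2 _ _ => //; case: sz1.
apply: (runs_post _ (runs_fill_cell inp3 sz2 lt_in lt_k _ vk _ _ t1));
  try by rewrite ag2.1.
move=> st3 [ta tc]; split=> [k' ltk' | k' | i' lti' k' ltk' | k'] /=.
- by rewrite ta (ltn_eqF (ltnSn i)) /= t1.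
- rewrite ta eqxx ltnS leq_eqVlt /= => /predU1P[->|lt_k']; first by rewrite eqxx.
  by rewrite (ltn_eqF lt_k') t2.
- by rewrite tc (ltn_eqF lti') /= c1.
- rewrite tc eqxx ltnS leq_eqVlt /= => /predU1P[->|lt_k']; first by rewrite eqxx.
  by rewrite (ltn_eqF lt_k') c2.
Qed.


Lemma runs_find_best st :
  input st -> sized st -> table_row n st ->
  runs find_best st (fun st' => exists b,
      [/\ var st' vBest = b%:R, (b <= max_gain)%N, mw n b C <= B
        & forall b', (b' <= max_gain)%N -> mw n b' C <= B -> (b' <= b)%N])
    (1 + (max_gain.+1 * (5 + 3) + 2)).
Proof.
move=> inp sz row; apply: runs_seq; apply: runs_assign.
pose Inv k st' := exists b,
  [/\ var st' vBest = b%:R, (b <= max_gain)%N, mw n b C <= B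
    & forall b', (b' < k)%N -> mw n b' C <= B -> (b' <= b)%N].
apply: (runs_post (Q := fun st' => Inv max_gain.+1 st' /\ _)).
  by move=> st' [[b [h1 h2 h3 h4]] _]; exists b; split=> // b'; exact: h4.
apply: (runs_for (Inv := Inv)) => //; first exact: (sized_rows sz).
  exists 0%N; split=> //; apply: le_trans B_ge0.
  have := @min_weight_le _ (B + 1) w g gain lv n (fun _ => 0%N) 0 C.
  by rewrite /= !big1 // => -> // i.
move=> k st1; rewrite ltnS => le_k ag vk [b [vb leb hb hmax]].
have inp1 : input st1 by apply: input_agree ag _ _ _ => //; case: inp.
have sz1 : sized st1 by apply: sized_agree ag _ _ => //; case: sz.
have row1 : table_row n st1 by move=> k' lt_k'; rewrite ag.2 // row.
apply: (@runs_le _ _ _ _ (4 + maxn 1 0)) => //.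
apply: runs_if => /=; rewrite vk (input_n inp1) (sized_cols sz1) (input_C inp1)
  -natrM -natrD !natrK row1 ?column_lt // /entry column_divn // column_modn //
  (input_B inp1) => h.
  apply: runs_assign; exists k; split=> //= b'; rewrite ltnS => //.
apply: runs_skip; exists b; split=> //= b'.
rewrite ltnS leq_eqVlt => /predU1P[->|]; last exact: hmax.
by move=> h'; rewrite h' in h.
Qed.

Definition written f i st : Prop :=
  arr st aX i 0 = (0 < f i)%N%:R /\
  forall l, (l <= lv i)%N -> arr st aY i l = (l < f i)%N%:R.

Lemma runs_write_levels st i d (P : state R -> Prop) :
  (i < n)%N -> var st vI = i%:R -> var st vD = d%:R ->
  var st vLim = (lv i).+1%:R ->
  (forall st', agree_off [:: vL] [:: aY] st st' ->
     (forall i' l, i' != i -> arr st' aY i' l = arr st aY i' l) ->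
     (forall l, (l <= lv i)%N -> arr st' aY i l = (l < d)%N%:R) -> P st') ->
  runs write_levels st P (Q.+1 * (2 + 3) + 2).
Proof.
move=> lt_in vi vd vl post.
apply: (@runs_le _ _ _ _ ((lv i).+1 * (2 + 3) + 2)); last first.
  by rewrite leq_add2r leq_mul2r ltnS lvQ ?orbT.
pose Inv j st' := (forall i' l, i' != i -> arr st' aY i' l = arr st aY i' l) /\
   (forall l, (l < j)%N -> arr st' aY i l = (l < d)%N%:R).
apply: (runs_post (Q := fun st' => Inv (lv i).+1 st' /\ _)); last first.
  apply: (runs_for (Inv := Inv)) => //.
  move=> j st1 _ ag vj [h1 h2].
  have vi1 : var st1 vI = i%:R by rewrite ag.1.
  have vd1 : var st1 vD = d%:R by rewrite ag.1.
  have new b : b = (j < d)%N -> Inv j.+1 (set_var (set_arr st1 aY i j b%:R) vL j.+1%:R).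
    move=> ->; split=> [i' l /negPf ne|l] /=; first by rewrite ne h1 // ne.
    rewrite eqxx ltnS leq_eqVlt => /predU1P[->|lt_l]; first by rewrite eqxx.
    by rewrite (ltn_eqF lt_l) h2.
  apply: (@runs_le _ _ _ _ (1 + maxn 1 1)) => //.
  apply: runs_if; rewrite /= vj vd1 ltr_nat => h; apply: runs_write;
    rewrite /= vi1 vj !natrK.
    by apply: (new true); rewrite h.
  by apply: (new false); rewrite (negPf h).
move=> st' [[h1 h2] ag]; apply: post => //.
by apply: agree_off_sub ag => x; rewrite /= !inE ?orbb.
Qed.

(** Invariant: the decisions made for the last items, together with the best
    completion by the first ones, stay within both budgets and reach gain [b].
    When no items remain, the completion has weight 0 or B + 1, according to
    whether a gain of 0 is left; the budget excludes the latter. *)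
Lemma runs_trace_back st b :
  input st -> sized st -> var st vMax = m -> var st vBest = b%:R ->
  (b <= max_gain)%N -> mw n b C <= B ->
  (forall i, (i < n)%N -> choice_row i st) ->
  runs trace_back st (fun st' => exists f,
      [/\ forall i, (i < n)%N -> (f i <= (lv i).+1)%N /\ written f i st',
          \sum_(i < n) weight_of w i (f i) <= B,
          (\sum_(i < n) cost_of g i (f i) <= C)%N
        & (b <= \sum_(i < n) gain_of gain i (f i))%N])
    (2 + (n * (26 + (Q.+1 * (2 + 3) + 2) + 3) + 2)).
Proof.
move=> inp sz vm vb leb hb ch.
apply: (@runs_le _ _ _ _ (1 + (1 + (n * (26 + (Q.+1 * (2 + 3) + 2) + 3) + 2)))) => //.
apply: runs_seq; apply: runs_assign; apply: runs_seq; apply: runs_assign.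
pose Inv j st' := exists f P c,
  [/\ [/\ var st' vP = P%:R, var st' vCost = c%:R & (P <= max_gain)%N],
      forall i, (n - j <= i < n)%N -> (f i <= (lv i).+1)%N /\ written f i st',
      mw (n - j) P c + \sum_(n - j <= i < n) weight_of w i (f i) <= B,
      (c + \sum_(n - j <= i < n) cost_of g i (f i) <= C)%N
    & (b <= P + \sum_(n - j <= i < n) gain_of gain i (f i))%N].
apply: (runs_post (Q := fun st' => Inv n st' /\ _)).
  move=> st' [[f [P [c]]]]; rewrite subnn => -[_ fP hw hc hq] _.
  rewrite !big_mkord in hw hc hq.
  have w0 : 0 <= \sum_(i < n) weight_of w i (f i).
    apply: sumr_ge0 => i _; have [+ _] := fP i (ltn_ord i).
    by case: (f i) => //= l le_l; exact: w_ge0.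
  exists f; split=> //.
  - by apply: le_trans hw; rewrite lerDr; case: (P) => //=; rewrite addr_ge0.
  - exact: leq_trans (leq_addl _ _) hc.
  case: P hw hq => // P /= hw; exfalso; move: hw; rewrite leNgt.
  by rewrite -addrA ltrDl (lt_le_trans ltr01) // lerDl.
apply: (runs_for (Inv := Inv)) => //; first by rewrite /= (input_n inp).
  exists (fun _ => 0%N), b, C; rewrite subn0 !big_geq // !addr0 !addn0; split=> //.
    by split=> //=; rewrite (input_C inp).
  by move=> i /andP[h1 h2]; rewrite leqNgt h2 in h1.
move=> j st1 lt_j ag vj [f [P [c [[valP valc leP] fP hw hc hq]]]].
have inp1 : input st1 by apply: input_agree ag _ _ _ => //; case: inp.
have sz1 : sized st1 by apply: sized_agree ag _ _ => //; case: sz.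
have vm1 : var st1 vMax = m by rewrite ag.1.
pose i := (n - 1 - j)%N.
have lt_in : (i < n)%N by rewrite /i; lia.
have ei : (n - j = i.+1)%N by rewrite /i; lia.
have ei' : (n - j.+1 = i)%N by rewrite /i; lia.
have ch1 : choice_row i st1 by move=> k lt_k; rewrite ag.2 // ch.
have lec : (c <= C)%N by exact: leq_trans (leq_addr _ _) hc.
rewrite ei in fP hw hc hq.
pose d := choice (B + 1) w g gain lv i P c.
have [led lecd mwE] := select_attained w g gain (mw i) i P c (lv i).+1.
rewrite -/(choice (B + 1) w g gain lv i P c) -/d in led lecd mwE.
pose f' i' := if i' == i then d else f i'.
have f'i : f' i = d by rewrite /f' eqxx.
have f'ne i' : (i < i')%N -> f' i' = f i' by rewrite /f' => /gtn_eqF ->.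
have sumw : \sum_(i.+1 <= k < n) weight_of w k (f' k)
          = \sum_(i.+1 <= k < n) weight_of w k (f k).
  by apply: eq_big_nat => k /andP[lt_k _]; rewrite f'ne.
have sumc : (\sum_(i.+1 <= k < n) cost_of g k (f' k)
          = \sum_(i.+1 <= k < n) cost_of g k (f k))%N.
  by apply: eq_big_nat => k /andP[lt_k _]; rewrite f'ne.
have sumq : (\sum_(i.+1 <= k < n) gain_of gain k (f' k)
          = \sum_(i.+1 <= k < n) gain_of gain k (f k))%N.
  by apply: eq_big_nat => k /andP[lt_k _]; rewrite f'ne.
eapply runs_le.
  apply: runs_seq; apply: runs_assign.
  rewrite [eval _ _]/= (input_n inp1) vj -!natrB; [|lia|lia].
  rewrite -/i; set st2 := set_var _ _ _.
  have inp2 : input st2 by case: inp1.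
  apply: runs_seq; apply: (runs_scale_profit inp2 lt_in) => //.
  set st3 := set_var _ _ _; have inp3 : input st3 by case: inp2.
  apply: runs_seq; apply: (runs_count_levels inp3 lt_in) => //.
  apply: runs_seq; apply: runs_assign.
  rewrite [eval _ _]/= valP valc (sized_cols sz1) -natrM -natrD !natrK.
  rewrite ch1 ?column_lt // /best_level column_divn // column_modn // -/d.
  apply: runs_seq; set st4 := set_var _ _ _.
  have inp4 : input st4 by case: inp3.
  (* After the choice at item i has been read, both branches lead to a state
     of this form. *)
  have after st5 : agree_off [:: vP; vCost] [:: aX] st4 st5 ->
      var st5 vP = (P - gain_of gain i d)%N%:R ->
      var st5 vCost = (c - cost_of g i d)%N%:R ->
      (forall i', i' != i -> arr st5 aX i' 0 = arr st4 aX i' 0) ->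
      arr st5 aX i 0 = (0 < d)%N%:R ->
      runs write_levels st5 (fun st' => Inv j.+1 (set_var st' vJ j.+1%:R))
        (Q.+1 * (2 + 3) + 2).
    move=> ag5 vP5 vc5 x5 xi5.
    apply: (runs_write_levels (i := i) (d := d)) => //; try by rewrite ag5.1.
    move=> st6 ag6 y6 yi6.
    exists f', (P - gain_of gain i d)%N, (c - cost_of g i d)%N.
    rewrite ei' !(big_ltn lt_in) f'i.
    rewrite sumw sumc sumq.
    split.
    - by split; rewrite /= ?ag6.1 // (leq_trans (leq_subr _ _)).
    - move=> i' /andP[le_i lt_i]; rewrite /written /=.
      have [->|ne] := eqVneq i' i.
        by rewrite f'i ag6.2 // xi5; split=> //; split=> // l; exact: yi6.
      have lt_ii : (i < i')%N by rewrite ltn_neqAle eq_sym ne.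
      have [fi [xi yi]] := fP i' (introT andP (conj lt_ii lt_i)).
      rewrite f'ne // ag6.2 // x5 //; split=> //; split=> // l le_l.
      by rewrite y6 // ag5.2 //; exact: yi.
    - by rewrite addrA [_ + weight_of _ _ _]addrC -mwE.
    - by rewrite addnA subnK.
    - by apply: leq_trans hq _; rewrite addnA leq_add2r addnC -leq_subLR.
  apply: runs_if; rewrite /= ltr_nat => hd.
    have ed : d = d.-1.+1 by rewrite prednK.
    apply: runs_seq; apply: runs_write; rewrite /= !natrK.
    apply: runs_seq; apply: runs_assign.
    rewrite [eval _ _]/= -natrB // !natrK.
    rewrite (input_g inp1) //; last by rewrite -ltnS subn1 -ed.
    rewrite valc -natrB; last by move: lecd; rewrite {1}ed /= subn1.
    apply: (@runs_reduce_profit _ _ P (gain i)) => //.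
    apply: after => //=.
    + split=> [v|a ha r k] /=; first by rewrite !inE !negb_or => /andP[/negPf-> /negPf->].
      by move: ha; rewrite inE => /negPf ->.
    + by rewrite ed.
    + by rewrite {2}ed /= subn1.
    + by move=> i' /negPf ->.
    + by rewrite eqxx hd.
  apply: runs_write; rewrite /= !natrK; apply: after => //=.
  + by split=> [v|a ha r k] //=; move: ha; rewrite inE => /negPf ->.
  + by rewrite valP; case: (d) hd => //=; rewrite subn0.
  + by rewrite valc; case: (d) hd => //=; rewrite subn0.
  + by move=> i' /negPf ->.
  + by rewrite eqxx (negPf hd).
by rewrite /=; lia.
Qed.

Definition value (f : nat -> nat) : R := \sum_(i < n) p i * (0 < f i)%N%:R.

Definition fitting f : Prop :=
  [/\ forall i, (i < n)%N -> (f i <= (lv i).+1)%N,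
      \sum_(i < n) weight_of w i (f i) <= B
    & (\sum_(i < n) cost_of g i (f i) <= C)%N].

(** Rounding down: a unit of gain stands for a profit of
    [eps * m / n]. *)
Lemma gain_of_ge i d : (i < n)%N ->
  (gain_of gain i d)%:R * (eps * m / n%:R) <= p i * (0 < d)%N%:R.
Proof.
move=> lt_in; case: d => [|d] /=; first by rewrite mul0r mulr0.
have n_gt0 : 0 < n%:R :> R by rewrite ltr0n (leq_ltn_trans _ lt_in).
rewrite mulr1; have [->|m_neq0] := eqVneq m 0.
  by rewrite mulr0 mul0r mulr0 p_ge0.
have m_gt0 : 0 < m by rewrite lt_def m_neq0.
rewrite mulrA ler_pdivrMr // -ler_pdivlMr ?mulr_gt0 //.
by rewrite truncn_le divr_ge0 ?mulr_ge0 ?p_ge0 ?ler0n // ltW.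
Qed.

Section Fitting.
Hypothesis m_max : max_fitting (fun _ _ => true) m.

(** Weights and costs are nonnegative, so each item of a fitting choice fits on
    its own and was seen when [m] was computed. *)
Lemma fitting_profit_le f i : fitting f -> (i < n)%N -> (0 < f i)%N -> p i <= m.
Proof.
move=> [fl fw fc] lt_in; have [_ mU _] := m_max.
have wi : weight_of w i (f i) <= B.
  apply: le_trans fw; rewrite (bigD1 (Ordinal lt_in)) //= lerDl.
  apply: sumr_ge0 => j _; case E: (f j) => //= [l].
  by apply: w_ge0 => //; rewrite -ltnS -E fl.
have ci : (cost_of g i (f i) <= C)%N.
  by apply: leq_trans fc; rewrite (bigD1 (Ordinal lt_in)) //= leq_addr.
case E: (f i) wi ci => [//|l] /= wi ci _; apply: (mU i l) => //.
by rewrite -ltnS -E fl.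
Qed.

Lemma fitting_gain_le f : fitting f ->
  (\sum_(i < n) gain_of gain i (f i) <= max_gain)%N.
Proof.
move=> fit; rewrite truncn_ge_nat ?divr_ge0 ?mulr_ge0 ?ler0n ?(ltW eps_gt0) //.
rewrite natr_sum -mulrA mulr_natl.
have -> : (n%:R / eps) *+ n = \sum_(i < n) n%:R / eps.
  by rewrite sumr_const card_ord.
apply: ler_sum => i _; case E: (f i) => [|l] /=.
  by rewrite divr_ge0 ?ler0n // ltW.
have pm : p i <= m by apply: fitting_profit_le fit _ _ => //; rewrite E.
rewrite /gain; have [->|m_neq0] := eqVneq m 0.
  by rewrite mulr0 invr0 mulr0 truncn0 divr_ge0 ?ler0n // ltW.
have m_gt0 : 0 < m by rewrite lt_def m_neq0.
apply: (@le_trans _ _ (p i * n%:R / (eps * m))).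
  by rewrite truncn_le divr_ge0 ?mulr_ge0 ?p_ge0 ?ler0n // ltW.
rewrite ler_pdivrMr ?mulr_gt0 // mulrA divfK ?gt_eqF // mulrC.
by rewrite ler_wpM2l ?ler0n.
Qed.

(** Rounding loses at most one unit [eps * m / n] per item. *)
Lemma gain_of_le f i : fitting f -> (i < n)%N ->
  p i * (0 < f i)%N%:R - eps * m / n%:R
    <= (gain_of gain i (f i))%:R * (eps * m / n%:R).
Proof.
move=> fit lt_in.
have n_gt0 : 0 < n%:R :> R by rewrite ltr0n (leq_ltn_trans _ lt_in).
have k_ge0 : 0 <= eps * m / n%:R by rewrite divr_ge0 ?mulr_ge0 // ltW.
case E: (f i) => [|d] /=; first by rewrite mul0r mulr0 sub0r oppr_le0.
have pm : p i <= m by apply: fitting_profit_le fit _ _ => //; rewrite E.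
rewrite mulr1 lerBlDr -[X in _ + X]mul1r -mulrDl natr1.
have [m0|m_neq0] := eqVneq m 0.
  by rewrite m0 in pm; apply: le_trans pm _; rewrite mulr_ge0 ?ler0n.
have m_gt0 : 0 < m by rewrite lt_def m_neq0.
rewrite mulrA ler_pdivlMr // -ler_pdivrMr ?mulr_gt0 //.
exact: ltW (truncnS_gt _).
Qed.

Lemma value_approx (f f' : nat -> nat) : (0 < n)%N -> fitting f' ->
  (\sum_(i < n) gain_of gain i (f' i) <= \sum_(i < n) gain_of gain i (f i))%N ->
  m <= value f' -> (1 - eps) * value f' <= value f.
Proof.
move=> n_gt0 fit' le_gain le_m; pose k := eps * m / n%:R.
have nR : n%:R != 0 :> R by rewrite pnatr_eq0 -lt0n.
have k_ge0 : 0 <= k by rewrite divr_ge0 ?mulr_ge0 ?ler0n // ltW.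
have up : value f' - eps * m <= (\sum_(i < n) gain_of gain i (f' i))%N%:R * k.
  have -> : eps * m = \sum_(i < n) k.
    by rewrite sumr_const card_ord -[RHS]mulr_natr /k divfK.
  rewrite -sumrB natr_sum mulr_suml; apply: ler_sum => i _.
  exact: gain_of_le.
have down : (\sum_(i < n) gain_of gain i (f i))%N%:R * k <= value f.
  by rewrite natr_sum mulr_suml; apply: ler_sum => i _; exact: gain_of_ge.
apply: le_trans down; apply: (@le_trans _ _ (value f' - eps * m)).
  by rewrite mulrBl mul1r lerD2l lerN2 ler_wpM2l // ltW.
by apply: le_trans up _; rewrite ler_wpM2r // ler_nat.
Qed.

Lemma max_fitting_attained : exists2 f, fitting f & m <= value f.
Proof.
have [_ _ [->|[i [l [lt_in le_l wi ci ->]]]]] := m_max.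
  exists (fun _ => 0%N); first by split; rewrite ?big1.
  by rewrite /value big1 // => i _; rewrite mulr0.
exists (fun j => if j == i then l.+1 else 0%N).
  split=> [j _||]; first by case: eqP => // ->.
  - rewrite (bigD1 (Ordinal lt_in)) //= eqxx /= big1 ?addr0 // => j.
    by rewrite -val_eqE /= => /negPf ->.
  - rewrite (bigD1 (Ordinal lt_in)) //= eqxx /= big1 ?addn0 // => j.
    by rewrite -val_eqE /= => /negPf ->.
rewrite /value (bigD1 (Ordinal lt_in)) //= eqxx mulr1 lerDl.
by apply: sumr_ge0 => j _; rewrite mulr_ge0 ?p_ge0 ?ler0n.
Qed.

End Fitting.
End Table.

(** Every loop nest takes time proportional to some factors of
    [n * cells * Q.+1], all of them at least 1; 200 is a round bound for the sum
    of the constants. *)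
Lemma fptas_time : (0 < n)%N ->
  (1 + (n * (3 + (Q.+1 * (8 + 3) + 2) + 3) + 2) + (9 + (cells * (3 + 3) + 2 +
   (n * (6 + (3 + (cells * (16 + (Q.+1 * (14 + 3) + 2) + 3) + 2)) + 3) + 2 +
    (1 + (max_gain.+1 * (5 + 3) + 2) +
     (2 + (n * (26 + (Q.+1 * (2 + 3) + 2) + 3) + 2))))))
   <= 200 * (n * cells * Q.+1))%N.
Proof.
move=> n0; have c0 : (max_gain.+1 <= cells)%N by rewrite leq_pmulr.
set X := (n * cells * Q.+1)%N.
have nc : (n * cells <= X)%N by rewrite leq_pmulr.
have cX : (cells <= X)%N by apply: leq_trans nc; rewrite leq_pmull.
have nQ : (n * Q.+1 <= X)%N by rewrite leq_mul2r leq_pmulr ?orbT // (leq_trans _ c0).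
have nX : (n <= X)%N by apply: leq_trans nQ; rewrite leq_pmulr.
have eX : (n * (cells * Q.+1) = X)%N by rewrite mulnA.
move: max_gain cells X c0 nc cX nQ nX eX => M c X c0 nc cX nQ nX eX.
lia.
Qed.

Lemma runs_fptas st : (0 < n)%N -> input st ->
  runs fptas st (fun st' => exists f,
    [/\ fitting f, forall i, (i < n)%N -> written f i st'
      & forall f', fitting f' ->
          (forall f'', fitting f'' -> value f'' <= value f') ->
          (1 - eps) * value f' <= value f])
    (200 * (n * cells * Q.+1)).
Proof.
move=> n_gt0 inp; apply: runs_le (fptas_time n_gt0).
apply: runs_seq; apply: runs_post (runs_agree (runs_find_max inp)).
move=> st1 [mx ag1]; set m := var st1 vMax in mx.
have m_ge0 : 0 <= m by case: mx.
have inp1 : input st1 by apply: input_agree ag1 _ _ inp.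
apply: runs_seq; apply: runs_post (runs_agree (runs_table_size inp1)).
move=> st2 [sz2 ag2].
have inp2 : input st2 by apply: input_agree ag2 _ _ inp1.
have vm2 : var st2 vMax = m by rewrite ag2.1.
apply: runs_seq; apply: runs_post (runs_agree (runs_fill_base m inp2 sz2)).
move=> st3 [row3 ag3].
have inp3 : input st3 by apply: input_agree ag3 _ _ inp2.
have sz3 : sized st3 by apply: sized_agree ag3 _ sz2.
have vm3 : var st3 vMax = m by rewrite ag3.1.
apply: runs_seq.
apply: runs_post (runs_agree (runs_fill_table m_ge0 inp3 sz3 vm3 row3)).
move=> st4 [[row4 ch4] ag4].
have inp4 : input st4 by apply: input_agree ag4 _ _ inp3.
have sz4 : sized st4 by apply: sized_agree ag4 _ sz3.
have vm4 : var st4 vMax = m by rewrite ag4.1.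
apply: runs_seq; apply: runs_post (runs_agree (runs_find_best inp4 sz4 row4)).
move=> st5 [[b [vb leb hb bmax]] ag5].
have inp5 : input st5 by apply: input_agree ag5 _ _ inp4.
have sz5 : sized st5 by apply: sized_agree ag5 _ sz4.
have vm5 : var st5 vMax = m by rewrite ag5.1.
have ch5 i : (i < n)%N -> choice_row m i st5.
  by move=> lt_in k lt_k; rewrite ag5.2 // ch4.
apply: runs_post (runs_trace_back m_ge0 inp5 sz5 vm5 vb leb hb ch5).
move=> st6 [f [fl fw fc fb]]; exists f; split.
- by split=> // i /fl[].
- by move=> i /fl[].
move=> f' fit' opt'; apply: (value_approx m_ge0 mx) => //.
  apply: leq_trans fb; apply: bmax; first exact: fitting_gain_le mx _ fit'.
  by case: fit' => f'l f'w f'c; apply: le_trans f'w; exact: min_weight_le.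
have [f1 fit1 le_m] := max_fitting_attained mx.
exact: le_trans le_m (opt' _ fit1).
Qed.

End Program.

(** * Solutions as level choices *)

(** The increments selected by a nested assignment form a prefix, hence add up
    to the value at the chosen level. *)
Lemma telescope_prefix (V : pzRingType) (a : nat -> V) n k : (k <= n)%N ->
  \sum_(l < n) (a l.+1 - a l) * (l < k)%N%:R = a k - a 0%N.
Proof.
move=> le_kn; rewrite (eq_bigr (fun l : 'I_n =>
  if (l < k)%N then a l.+1 - a l else 0)); last first.
  by move=> l _; case: ifP => _; rewrite ?mulr1 ?mulr0.
rewrite -big_mkcond -(big_ord_widen _ (fun l => a l.+1 - a l)) //.
by rewrite -(big_mkord xpredT (fun l => a l.+1 - a l)) telescope_sumr.
Qed.

Section Codes.
Variables (R : archiRealFieldType) (I : instance R).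
Implicit Types (s : solution I) (f : nat -> nat).

Definition codes s f : Prop := forall i : 'I_(items I),
  [/\ (f i <= (levels i).+1)%N, xvar s i = (0 < f i)%N
    & forall l : 'I_(levels i), yvar s l = (l.+1 < f i)%N].

Lemma codes_objective s f (p : nat -> R) : codes s f ->
  (forall i : 'I_(items I), p i = profit i) ->
  objective s = value (items I) p f.
Proof.
by move=> cd ep; apply: eq_bigr => i _; have [_ -> _] := cd i; rewrite ep.
Qed.

Lemma codes_total_weight s f (w : nat -> nat -> R) : codes s f ->
  (forall (i : 'I_(items I)) l, (l <= levels i)%N -> w i l = weight i l) ->
  total_weight s = \sum_(i < items I) weight_of w i (f i).
Proof.
move=> cd ew; rewrite /total_weight -big_split; apply: eq_bigr => i _ /=.
have [le_f -> ey] := cd i.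
under eq_bigr do rewrite ey.
case: (f i) le_f => [|d] /= le_d.
  by rewrite mulr0 add0r big1 // => l _; rewrite mulr0.
under eq_bigr do rewrite ltnS.
by rewrite telescope_prefix // ew // mulr1 addrC subrK.
Qed.

Lemma codes_total_icost s f (g : nat -> nat -> nat) : codes s f ->
  (forall i : 'I_(items I), icost i 0 = 0) ->
  (forall (i : 'I_(items I)) l, (l <= levels i)%N -> icost i l = g i l) ->
  total_icost s = (\sum_(i < items I) cost_of g i (f i))%N :> int.
Proof.
move=> cd c0 eg; rewrite /total_icost -natz natr_sum; apply: eq_bigr => i _ /=.
have [le_f _ ey] := cd i.
under eq_bigr do rewrite ey.
case: (f i) le_f => [|d] /= le_d.
  by rewrite big1 // => l _; rewrite mulr0.
under eq_bigr do rewrite ltnS.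
by rewrite telescope_prefix // c0 subr0 eg // natz.
Qed.

Lemma codes_nested s f : codes s f -> nested s.
Proof.
move=> cd; apply/forallP => i; have [_ ex ey] := cd i.
apply/andP; split; apply/forallP => l.
  apply/implyP => _; rewrite ex ey.
  by case: (f i) => [|d] //=; rewrite leq_b1.
apply/forallP => l'; apply/implyP => /eqP el; rewrite !ey el.
by case: (ltnP l.+2 (f i)) => // /ltnW ->.
Qed.

Definition decode f : solution I :=
  ([ffun i : 'I_(items I) => (0 < f i)%N],
   [ffun t : {i : 'I_(items I) & 'I_(levels i)} =>
     ((tagged t).+1 < f (tag t))%N]).

Lemma codes_decode f : (forall i : 'I_(items I), (f i <= (levels i).+1)%N) ->
  codes (decode f) f.
Proof.
by move=> le_f i; split=> // [|l]; rewrite /xvar /yvar /decode /= ffunE.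
Qed.

(** Nestedness makes the chosen levels of an item an initial segment, so its
    length records them all. *)
Lemma nested_codes s : nested s -> exists f, codes s f.
Proof.
move=> /forallP ns.
pose y i (l : nat) := if insub l is Some l' then @yvar _ _ s i l' else false.
pose d (i : 'I_(items I)) := find (fun l => ~~ y i l) (iota 0 (levels i)).
pose h (i : 'I_(items I)) := if xvar s i then (d i).+1 else 0%N.
pose f k := if insub k is Some i then h i else 0%N.
exists f => i; have [/forallP n0 /forallP nS] := andP (ns i).
have -> : f i = h i by rewrite /f insubT // => lt_i; congr h; exact: val_inj.
have yE (l : 'I_(levels i)) : y i l = yvar s l.
  by rewrite /y insubT // => lt_l; congr (yvar s _); exact: val_inj.
have le_d : (d i <= levels i)%N by rewrite -[X in (_ <= X)%N](size_iota 0) find_size.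
have y_dec l k : (l + k < levels i)%N -> y i (l + k)%N -> y i l.
  elim: k => [|k IH]; first by rewrite addn0.
  rewrite addnS => lt_lk y_lk; have lt' := ltnW lt_lk; apply: IH => //.
  have := forallP (nS (Ordinal lt')) (Ordinal lt_lk).
  by rewrite eqxx /= -!yE /= y_lk; case: (y i _).
rewrite /h; split.
- by case: ifP.
- by case: ifP.
move=> l; rewrite -yE; case xi: (xvar s i); last first.
  have lt0 : (0 < levels i)%N by apply: leq_ltn_trans (ltn_ord l).
  have := n0 (Ordinal lt0); rewrite xi /= -yE /=.
  have := @y_dec 0%N l (ltn_ord l); rewrite add0n.
  by case: (y i l) => // ->.
rewrite ltnS; case: (ltnP l (d i)) => [lt_l|le_l].
  have := before_find 0%N lt_l; rewrite nth_iota ?add0n //.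
  by move/negbFE.
apply/negP => yl.
have lt_d : (d i < levels i)%N := leq_ltn_trans le_l (ltn_ord l).
have : y i (d i) by apply: (y_dec _ (l - d i)%N); rewrite subnKC.
have := @nth_find _ 0%N (fun l => ~~ y i l) (iota 0 (levels i)).
rewrite has_find size_iota -/(d i) nth_iota // add0n => /(_ lt_d).
by move/negPf ->.
Qed.

End Codes.

Theorem theorem4p3 :
  exists (prog : cmd) (K : nat),
  forall (R : archiRealFieldType) (I : instance R) (eps : R) (st : state R),
    valid I -> 0 < eps < 1 -> encodes st I eps ->
  exists (st' : state R) (t : nat) (s : solution I),
    [/\ exec prog st st' t,
        returns st' s,
        feasible s,
        (1 - eps) * opt I <= objective s
      & t%:R <= K%:R * ((items I)%:R ^+ 3 * (maxlevel I)%:R * (ibudget I)%:~R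
                        / eps)].
Proof.
exists fptas, 1600%N => R I eps st vI /andP[e0 e1] en.
pose n := items I; pose Q := maxlevel I; pose C := `|ibudget I|%N.
pose p i := arr st 0%N i 0%N; pose lv i := Num.truncn (arr st 1%N i 0%N).
pose w := arr st 2%N; pose g i l := Num.truncn (arr st 3%N i l).
have eC : ibudget I = C by rewrite /C gez0_abs // ltW // ibudget_gt0.
have ep (i : 'I_n) : p i = profit i by exact: (in_profit en).
have elv (i : 'I_n) : lv i = levels i by rewrite /lv (in_levels en) natrK.
have ew (i : 'I_n) l : (l <= levels i)%N -> w i l = weight i l.
  exact: (in_weight en).
have cost_ge0 (i : 'I_n) l : (l <= levels i)%N -> 0 <= icost i l.
  elim: l => [|l IH] lt_l; first by rewrite icost0.
  by apply: le_trans (IH (ltnW lt_l)) _; exact: icost_nondec.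
have cE (i : 'I_n) l : (l <= levels i)%N -> icost i l = `|icost i l|%N.
  by move=> le_l; rewrite gez0_abs // cost_ge0.
have eg (i : 'I_n) l : (l <= levels i)%N -> icost i l = g i l.
  by move=> le_l; rewrite /g (in_icost en) // cE // natrK.
have weight_ge0 (i : 'I_n) l : (l <= levels i)%N -> 0 <= weight i l.
  move=> le_l; rewrite -(subKn le_l).
  elim: (levels i - l)%N (leq_subr l (levels i)) => [|k IH] le_k.
    by rewrite subn0 weight_last.
  have le_k' := ltnW le_k; apply: le_trans (IH le_k') _.
  have -> : (levels i - k = (levels i - k.+1).+1)%N by rewrite subnSK.
  by apply: weight_noninc => //; rewrite ltn_subrL (leq_ltn_trans _ le_k).
have n_gt0 : (0 < n)%N.
  case: (posnP n) => // n0; have := maxlevel_ge1 vI.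
  rewrite /maxlevel big1 // => i _.
  by have := ltn_ord i; rewrite [X in (_ < X)%N]n0.
have p_ge0 i : (i < n)%N -> 0 <= p i.
  by move=> lt_i; rewrite (ep (Ordinal lt_i)) profit_ge0.
have w_ge0 i l : (i < n)%N -> (l <= lv i)%N -> 0 <= w i l.
  move=> lt_i; rewrite (elv (Ordinal lt_i)) => le_l.
  by rewrite (ew (Ordinal lt_i)) // weight_ge0.
have lvQ i : (i < n)%N -> (lv i <= Q)%N.
  move=> lt_i; rewrite (elv (Ordinal lt_i)).
  exact: (leq_bigmax (Ordinal lt_i)).
have inp : input n C (kbudget I) eps p lv w g st.
  split=> //.
  - exact: in_items en.
  - exact: in_kbudget en.
  - by rewrite (in_ibudget en) eC.
  - exact: in_eps en.
  - by move=> i lt_i; rewrite (elv (Ordinal lt_i)) (in_levels en (Ordinal lt_i)).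
  - move=> i l lt_i; rewrite (elv (Ordinal lt_i)) => le_l.
    by rewrite (@in_icost _ _ _ _ en (Ordinal lt_i) l le_l) (eg (Ordinal lt_i)).
have feas (s : solution I) f : codes s f ->
    feasible s <-> fitting n C (kbudget I) lv w g f.
  move=> cd; rewrite /feasible (codes_total_weight cd ew).
  rewrite (codes_total_icost cd (icost0 vI) eg) eC lez_nat (codes_nested cd) andbT.
  split=> [/andP[fw fc]|[_ fw fc]]; last by apply/andP.
  by split=> // i lt_i; rewrite (elv (Ordinal lt_i)); case: (cd (Ordinal lt_i)).
have [st' [t [ex le_t [f [fit wr apx]]]]] :=
  runs_fptas p_ge0 w_ge0 (kbudget_ge0 vI) e0 lvQ n_gt0 inp.
have codes_fit f' : fitting n C (kbudget I) lv w g f' -> codes (decode I f') f'.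
  by move=> [fl _ _]; apply: codes_decode => i; rewrite -elv fl.
exists st', t, (decode I f); split=> //.
- split=> [i|i l]; have [wx wy] := wr i (ltn_ord i).
    by rewrite wx; case: (codes_fit f fit i) => _ ->.
  case: (codes_fit f fit i) => _ _ ->; rewrite wy // elv; exact: ltn_ord.
- exact/(feas _ _ (codes_fit f fit)).
- have [[s0 feas0 obj0] opt_ge] := opt_max vI.
  have [f0 cd0] : exists f0, codes s0 f0.
    by apply: nested_codes; case/and3P: feas0.
  rewrite -obj0 (codes_objective cd0 ep) (codes_objective (codes_fit f fit) ep).
  apply: apx; first exact/(feas _ _ cd0).
  move=> f'' fit''; rewrite -(codes_objective cd0 ep) obj0.
  rewrite -(codes_objective (codes_fit f'' fit'') ep); apply: opt_ge.
  exact/(feas _ _ (codes_fit _ fit'')).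
have C_gt0 : (0 < C)%N by rewrite -ltz_nat -eC ibudget_gt0.
have Q_gt0 : (0 < Q)%N := maxlevel_ge1 vI.
have G0 : 1 <= n%:R * n%:R / eps.
  rewrite ler_pdivlMr // mul1r (le_trans (ltW e1)) // -natrM ler1n.
  by rewrite muln_gt0 n_gt0.
have rows_le : (max_gain n eps).+1%:R <= 2%:R * (n%:R * n%:R / eps) :> R.
  rewrite -natr1 mulr_natl mulr2n lerD // truncn_le.
  exact: le_trans ler01 G0.
have le_T : (200 * (n * cells n C eps * Q.+1)
    <= 200 * (n * ((max_gain n eps).+1 * (2 * C)) * (2 * Q)))%N.
  by rewrite leq_mul2l /= leq_mul ?leq_mul //; lia.
(* Each of the three summands 1 at most doubles its factor, whence 1600, which
   is 8 * 200. *)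
rewrite eC; apply: (@le_trans _ _
  (200 * (n * ((max_gain n eps).+1 * (2 * C)) * (2 * Q)))%N%:R).
  by rewrite ler_nat (leq_trans le_t).
have -> : 1600%:R * (n%:R ^+ 3 * Q%:R * (C : int)%:~R / eps) =
    (800 * n * C * Q)%N%:R * (2%:R * (n%:R * n%:R / eps)) :> R.
  rewrite !natrM -[(C : int)%:~R]/(C%:R); field; exact: lt0r_neq0.
apply: le_trans (ler_wpM2l (ler0n _ _) rows_le).
by rewrite -natrM ler_nat; lia.
Qed.
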